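(* Boolean-width and component twin-width are functionally equivalent: there is a function $f:\mathbb N\to\mathbb N$ such that for every finite graph $G$, $\mathrm{ltww}(G)\le f(\mathrm{boolw}(G))$ and $\mathrm{boolw}(G)\le f(\mathrm{ltww}(G))$, where $\mathrm{boolw}$ denotes boolean-width and $\mathrm{ltww}$ component twin-width.
   Context: Graphs are finite and simple. For a bipartition $(X,Y)$ of $V(G)$, $\mathrm{bool}(X,Y)$ is $\log_2$ of the number of distinct subsets of $Y$ of the form $N(S)\cap Y$ with $S\subseteq X$ ($N(S)$ the set of vertices adjacent to some vertex of $S$). A branch decomposition of $G$ is a tree whose internal nodes have degree 3 and whose leaves are in bijection with $V(G)$; each tree edge induces a bipartition of $V(G)$ given by the leaf sets of the two components after removing the edge. The boolean-width of $G$ is the minimum over branch decompositions of the maximum of $\mathrm{bool}$ over the bipartitions induced by its edges. A partition sequence of an $n$-vertex graph $G$ is a sequence $\mathcal P_n,\dots,\mathcal P_1$ of partitions of $V(G)$ where $\mathcal P_n$ consists of singletons, $\mathcal P_1=\{V(G)\}$, and each $\mathcal P_i$ is obtained from $\mathcal P_{i+1}$ by merging two parts. Two disjoint vertex sets $X,Y$ are homogeneous if all or none of the pairs $x\in X$, $y\in Y$ are edges. The red graph of a partition $\mathcal P$ has vertex set $\mathcal P$ and an edge between distinct parts $X,Y$ whenever they are not homogeneous. The component twin-width $\mathrm{ltww}(G)$ is the minimum, over partition sequences, of the maximum over $i$ of the largest number of parts in a connected component of the red graph of $\mathcal P_i$. *)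

(* Defs.v *)
From mathcomp Require Import all_boot all_order all_algebra.
From mathcomp Require classical_sets exp.
From mathcomp Require Import reals.

Set Implicit Arguments.
Unset Strict Implicit.
Unset Printing Implicit Defensive.

Import Order.TTheory GRing.Theory Num.Theory.

Record sgraph := SGraph {
  vertex :> finType;
  adj : rel vertex;
  adj_sym : symmetric adj;
  adj_irr : irreflexive adj }.

Definition degree (G : sgraph) (x : G) : nat := #|[set y | adj x y]|.

Definition nbhd (G : sgraph) (S : {set G}) : {set G} :=
  [set y | [exists x in S, adj x y]].

Definition is_tree (G : sgraph) : Prop :=
  [/\ 0 < #|G|,
      forall x y : G, connect (@adj G) x y
    & forall c : seq G, ucycle (@adj G) c -> size c <= 2].

(* A leaf is a node of degree at most 1, so that the one-node tree is the
   branch decomposition of a one-vertex graph. *)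
Record branch_decomposition (G : sgraph) := BranchDecomposition {
  bd_tree : sgraph;
  bd_treeP : is_tree bd_tree;
  bd_leaf : G -> bd_tree;
  bd_leaf_inj : injective bd_leaf;
  bd_leafP : forall t : bd_tree, (t \in codom bd_leaf) = (degree t <= 1);
  bd_internal : forall t : bd_tree, 1 < degree t -> degree t = 3 }.

Definition del_edge (G : sgraph) (x y : G) : rel G :=
  [rel u v | adj u v && ([set u; v] != [set x; y])].

Definition bd_side (G : sgraph) (D : branch_decomposition G)
    (x y : bd_tree D) : {set G} :=
  [set v | connect (del_edge x y) x (bd_leaf D v)].

Definition homogeneous (G : sgraph) (X Y : {set G}) : bool :=
  [forall x in X, forall y in Y, adj x y]
  || [forall x in X, forall y in Y, ~~ adj x y].

Definition merge_of (T : finType) (P Q : {set {set T}}) : Prop :=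
  exists A B : {set T},
    [/\ A \in P, B \in P, A != B & Q = (A :|: B) |: (P :\: [set A; B])].

(* P i is the partition with i parts; only 1 <= i <= #|G| is relevant. *)
Definition partition_sequence (G : sgraph) (P : nat -> {set {set G}}) : Prop :=
  [/\ forall i, 0 < i <= #|G| -> partition (P i) [set: G],
      P #|G| = [set [set x] | x : G],
      P 1 = [set [set: G]]
    & forall i, 0 < i < #|G| -> merge_of (P i.+1) (P i)].

Definition red (G : sgraph) (P : {set {set G}}) : rel {set G} :=
  [rel X Y | [&& X \in P, Y \in P, X != Y & ~~ homogeneous X Y]].

Definition red_component_size (G : sgraph) (P : {set {set G}}) : nat :=
  \max_(X in P) #|[set Y in P | connect (red P) X Y]|.

Definition partition_sequence_width (G : sgraph) (P : nat -> {set {set G}}) :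
    nat :=
  \max_(1 <= i < #|G|.+1) red_component_size (P i).

(* The least element of A, or x0 if there is none. *)
Definition minimum (d : Order.disp_t) (T : porderType d) (x0 : T)
    (A : classical_sets.set T) : T :=
  classical_sets.xget x0
    (fun m => A m /\ forall x, A x -> (m <= x)%O).

Definition ltww (G : sgraph) : nat :=
  minimum 0 (fun k => exists P : nat -> {set {set G}},
    partition_sequence P /\ k = partition_sequence_width P).

Local Open Scope ring_scope.

Definition log2 (R : realType) (x : R) : R := exp.ln x / exp.ln 2.

Definition boolcut (R : realType) (G : sgraph) (X Y : {set G}) : R :=
  log2 #|[set nbhd S :&: Y | S in powerset X]|%:R.

(* Each tree edge is visited in both orientations; boolcut is symmetric and
   nonnegative, so neither this nor the default 0 affects the maximum. *)
Definition bd_width (R : realType) (G : sgraph) (D : branch_decomposition G) :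
    R :=
  \big[Order.max/0]_(p : bd_tree D * bd_tree D | adj p.1 p.2)
    boolcut R (bd_side p.1 p.2) (bd_side p.2 p.1).

(* The graph with no vertices has no branch decomposition; its boolean-width
   is 0 by convention. *)
Definition boolw (R : realType) (G : sgraph) : R :=
  minimum 0 (fun w => exists D : branch_decomposition G, w = bd_width R D).

(* Main.v *)
(**
Both parameters are compared with rooted binary trees on the vertex set,
recorded as a derivation of [buildable P [set: G]]: the clusters (leaf sets of
subtrees) are assembled from singletons by disjoint unions, and all satisfy [P].

From boolean-width to component twin-width: rooting a branch decomposition at
an edge gives clusters X whose vertices have at most m = 2^boolw neighbourhoods
outside X. Contract bottom-up, merging inside each cluster the vertices with
the same neighbourhood outside it. Red edges never leave a cluster, and a
cluster in progress has at most 2m parts, m from each of its two children.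

From component twin-width to boolean-width: a union of red components of a
partition of the sequence is a cluster, and each part in it is homogeneous to
everything outside. Undoing one merge turns a red component into a union of red
components with boundedly many parts, so clusters can be assembled by induction
along the sequence, each with a cut of boundedly many neighbourhoods. The
resulting tree is rerooted at a leaf and realised as the covering graph of the
laminar family of its clusters.
*)
Require Import Defs.
From mathcomp Require Import all_boot all_order all_algebra.
From mathcomp Require Import reals.
From mathcomp Require boolp classical_sets exp.

Set Implicit Arguments.
Unset Strict Implicit.
Unset Printing Implicit Defensive.

(** * Rooted binary trees as derivations *)

Inductive buildable (T : finType) (P : {set T} -> Prop) : {set T} -> Prop :=
| buildable1 x : P [set x] -> buildable P [set x]
| buildableU X Y : buildable P X -> buildable P Y -> [disjoint X & Y] ->
    P (X :|: Y) -> buildable P (X :|: Y).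

Lemma buildableP (T : finType) (P : {set T} -> Prop) X : buildable P X -> P X.
Proof. by case. Qed.

Lemma buildable_neq0 (T : finType) (P : {set T} -> Prop) X :
  buildable P X -> X != set0.
Proof.
elim=> [x _|{}X Y _ nX _ _ _ _]; first by apply/set0Pn; exists x; rewrite inE.
by rewrite setU_eq0 negb_and nX.
Qed.

(** Peeling off one element at a time gives a caterpillar. With a trivial [P] it yields the
    existence of branch decompositions and partition sequences. *)
Lemma buildable_all (T : finType) (P : {set T} -> Prop) X :
  (forall Y, P Y) -> X != set0 -> buildable P X.
Proof.
move=> PT; elim: {X}#|X| {-2}X (leqnn #|X|) => [|n IH] X.
  by rewrite leqn0 cards_eq0 => ->.
move=> leX /set0Pn [x xX].
have [X0|nX0] := eqVneq (X :\ x) set0.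
  by rewrite -(setD1K xX) X0 setU0; apply: buildable1.
rewrite -(setD1K xX); apply: buildableU => //.
- exact: buildable1.
- by apply: IH => //; move: leX; rewrite (cardsD1 x) xX.
- by rewrite disjoints1 !inE eqxx.
Qed.

(** Rerooting at the leaf [v]: a cluster of the new tree is an old cluster avoiding [v] or the
    complement of an old one containing [v], hence the closure of [P] under complement. Putting [v]
    back above the new tree gives its top node degree 3 instead of 2. *)
Lemma buildable_setC1 (T : finType) (P : {set T} -> Prop) (v : T) :
  (forall X, P X -> P (~: X)) -> 1 < #|T| ->
  buildable P [set: T] -> buildable P [set~ v].
Proof.
move=> PC T1 bT.
(* Walking down from the root towards v, the complement of the current cluster
   is the cluster of the rest of the tree when rerooted at v. *)
suff: forall X, buildable P X -> v \in X ->
    X = [set: T] \/ buildable P (~: X) -> buildable P [set~ v].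
  by apply; [exact: bT | rewrite inE | left].
move=> X; elim=> {X} [x _|X Y bX IHX bY IHY dXY PXY].
  rewrite inE => /eqP <- [vT|//].
  by move: T1; rewrite -cardsT -vT cards1.
wlog vX : X Y bX IHX bY IHY dXY PXY / v \in X => [Hwlog|_].
  move=> vXY; have := vXY; rewrite inE => /orP [vX|vY].
    exact: (Hwlog X Y).
  rewrite setUC in PXY vXY *.
  by apply: (Hwlog Y X) => //; rewrite disjoint_sym.
move=> bXY; apply: IHX => //; right.
(* Seen from [X], the rest of the tree is the sibling [Y] joined to what lies beyond the parent; at
   the old root nothing lies beyond. *)
have eX : ~: X = Y :|: ~: (X :|: Y).
  apply/setP => z; rewrite !inE.
  by have [/(disjointFl dXY)->|_] := boolP (z \in Y); rewrite ?orbF.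
case: bXY => [XYT|bC]; first by rewrite eX XYT setCT setU0.
rewrite eX; apply: buildableU => //; last by rewrite -eX; apply/PC/(buildableP bX).
by rewrite -setI_eq0; apply/eqP/setP => z; rewrite !inE; do 2!case: (_ \in _).
Qed.

(** * From binary trees to partition sequences *)

Lemma connect_invariant (T : finType) (e : rel T) (C : {set T}) x y :
  (forall a b, a \in C -> e a b -> b \in C) ->
  x \in C -> connect e x y -> y \in C.
Proof.
move=> Ce xC /connectP [p ep ->]; elim: p x xC ep => //= a p IH x xC.
by case/andP=> /(Ce _ _ xC); apply: IH.
Qed.

(** * Homogeneous pairs and red components *)

Lemma homogeneousP (G : sgraph) (X Y : {set G}) :
  reflect {in X &, forall x x', {in Y &, forall y y', adj x y = adj x' y'}}
    (homogeneous X Y).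
Proof.
apply: (iffP orP) => [[] /forall_inP H x x' xX x'X y y' yY y'Y|H].
- by rewrite (forall_inP (H _ xX) _ yY) (forall_inP (H _ x'X) _ y'Y).
- apply/idP/idP => h.
    by case/negP: (forall_inP (H _ xX) _ yY).
  by case/negP: (forall_inP (H _ x'X) _ y'Y).
- have [/existsP[x /andP[xX /existsP[y /andP[yY xy]]]]|nE] :=
    boolP [exists x in X, exists y in Y, adj x y].
    left; apply/forall_inP => x' x'X; apply/forall_inP => y' y'Y.
    by rewrite (H x' x x'X xX y' y y'Y yY).
  right; apply/forall_inP => x xX; apply/forall_inP => y yY.
  apply: contra nE => xy; apply/existsP; exists x; rewrite xX /=.
  by apply/existsP; exists y; rewrite yY.
Qed.

Lemma homogeneousC (G : sgraph) (X Y : {set G}) :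
  homogeneous X Y = homogeneous Y X.
Proof.
by apply/homogeneousP/homogeneousP => H x x' xX x'X y y' yY y'Y;
  rewrite adj_sym [RHS]adj_sym; apply: H.
Qed.

(** A family closed under red edges contains the component of each of its members, so components
    need not be computed. *)
Lemma red_component_size_le (G : sgraph) (Q : {set {set G}}) k :
  (forall X, X \in Q -> exists2 C : {set {set G}}, X \in C /\ #|C| <= k
     & forall A B, A \in C -> red Q A B -> B \in C) ->
  red_component_size Q <= k.
Proof.
move=> H; apply/bigmax_leqP => X XQ.
have [C [XC Ck] Cred] := H X XQ.
apply: leq_trans Ck; apply/subset_leq_card/subsetP => Y.
by rewrite inE => /andP[_]; apply: connect_invariant.
Qed.

Lemma red_component_size_card (G : sgraph) (Q : {set {set G}}) :
  red_component_size Q <= #|Q|.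
Proof.
by apply: red_component_size_le => X XQ; exists Q => // A B _ /and4P[].
Qed.

(** No red edge joins [Q1] to [Q2], so a component of either one remains closed in the union. *)
Lemma red_component_size_setU (G : sgraph) (Q1 Q2 : {set {set G}}) k :
  {in Q1 & Q2, forall A B, homogeneous A B} ->
  red_component_size Q1 <= k -> red_component_size Q2 <= k ->
  red_component_size (Q1 :|: Q2) <= k.
Proof.
move=> hom /bigmax_leqP k1 /bigmax_leqP k2.
apply: red_component_size_le => X; rewrite inE => /orP[XQ|XQ].
- exists [set Y in Q1 | connect (red Q1) X Y].
    by rewrite inE XQ connect0; split; last exact: k1.
  move=> A B; rewrite inE => /andP[A1 cA] /and4P[_]; rewrite !inE.
  case: (boolP (B \in Q1)) => /= [B1 _ nAB hAB|_ B2 _]; last by rewrite hom.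
  by apply: connect_trans cA (connect1 _); rewrite /red /= A1 B1 nAB.
- exists [set Y in Q2 | connect (red Q2) X Y].
    by rewrite inE XQ connect0; split; last exact: k2.
  move=> A B; rewrite inE => /andP[A1 cA] /and4P[_]; rewrite !inE orbC.
  case: (boolP (B \in Q2)) => /= [B1 _ nAB hAB|_ B2 _].
    by apply: connect_trans cA (connect1 _); rewrite /red /= A1 B1 nAB.
  by rewrite homogeneousC hom.
Qed.

Definition singletons (T : finType) (X : {set T}) : {set {set T}} :=
  [set [set x] | x in X].

Lemma singletonsU (T : finType) (X Y : {set T}) :
  singletons (X :|: Y) = singletons X :|: singletons Y.
Proof. exact: imsetU. Qed.

Lemma partition_singletons (T : finType) (X : {set T}) :
  partition (singletons X) X.
Proof.
apply/and3P; split.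
- rewrite /cover big_imset /=; last by move=> x y _ _; apply: set1_inj.
  apply/eqP/setP => x; apply/bigcupP/idP => [[y yX]|xX].
    by rewrite inE => /eqP->.
  by exists x; rewrite ?inE.
- apply/trivIsetP => A B /imsetP[a _ ->] /imsetP[b _ ->] nab.
  by rewrite disjoints1 inE; apply: contra nab => /eqP->.
- by apply/imsetP => -[x _ /setP/(_ x)]; rewrite !inE eqxx.
Qed.

Lemma red_component_size_singletons (G : sgraph) (X : {set G}) :
  red_component_size (singletons X) <= 1.
Proof.
apply: red_component_size_le => A AX; exists [set A].
  by rewrite inE eqxx cards1.
move=> _ B /set1P-> /and4P[/imsetP[a _ ->] /imsetP[b _ ->] _].
case/negP; apply/homogeneousP => x x'; rewrite !inE => /eqP-> /eqP->.
by move=> y y'; rewrite !inE => /eqP-> /eqP->.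
Qed.

(** Vertices in a common part of [Q] are twins as seen from [X]. For [X] outside the parts, every
    part is homogeneous to every vertex of [X]. *)
Definition uniform_on (G : sgraph) (Q : {set {set G}}) (X : {set G}) :=
  forall A, A \in Q -> {in A &, forall a a', {in X, adj a =1 adj a'}}.

Lemma uniform_onS (G : sgraph) (Q : {set {set G}}) (X Y : {set G}) :
  X \subset Y -> uniform_on Q Y -> uniform_on Q X.
Proof.
by move=> /subsetP XY uQ A AQ a a' aA a'A v vX; apply: (uQ A) => //; apply: XY.
Qed.

Lemma uniform_onU (G : sgraph) (Q1 Q2 : {set {set G}}) (X : {set G}) :
  uniform_on Q1 X -> uniform_on Q2 X -> uniform_on (Q1 :|: Q2) X.
Proof. by move=> u1 u2 A; rewrite inE => /orP[/u1|/u2]. Qed.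

Lemma uniform_on_singletons (G : sgraph) (X Y : {set G}) :
  uniform_on (singletons X) Y.
Proof. by move=> A /imsetP[x _ ->] a a' /set1P-> /set1P->. Qed.

(** The two ends of a pair can be moved one after the other within their parts. This is why red
    edges never leave a cluster. *)
Lemma uniform_homogeneous (G : sgraph) (Q1 Q2 : {set {set G}}) X Y :
  partition Q1 X -> partition Q2 Y -> uniform_on Q1 Y -> uniform_on Q2 X ->
  {in Q1 & Q2, forall A B, homogeneous A B}.
Proof.
move=> p1 p2 u1 u2 A B AQ BQ; apply/homogeneousP => a a' aA a'A b b' bB b'B.
have sA := subsetP (partitionS p1 AQ).
have sB := subsetP (partitionS p2 BQ).
rewrite (u1 A AQ a a') ?sB // adj_sym (u2 B BQ b b') ?sA //.
exact: adj_sym.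
Qed.

Lemma partitionU (T : finType) (Q1 Q2 : {set {set T}}) (X Y : {set T}) :
  [disjoint X & Y] -> partition Q1 X -> partition Q2 Y ->
  partition (Q1 :|: Q2) (X :|: Y).
Proof.
move=> dXY p1 p2; case/and3P: (p1) (p2) => /eqP c1 t1 n1 /and3P[/eqP c2 t2 n2].
apply/and3P; split; last by rewrite inE negb_or n1.
  by rewrite /cover bigcup_setU -/(cover Q1) -/(cover Q2) c1 c2.
have d12 A B : A \in Q1 -> B \in Q2 -> [disjoint A & B].
  move=> /(partitionS p1) sA /(partitionS p2) sB.
  exact: disjointW sA sB dXY.
apply/trivIsetP => A B; rewrite !inE => /orP[A1|A2] /orP[B1|B2] nAB.
- exact: (trivIsetP t1).
- exact: d12.
- by rewrite disjoint_sym d12.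
- exact: (trivIsetP t2).
Qed.

Definition merge_parts (T : finType) (Q : {set {set T}}) (A B : {set T}) :=
  (A :|: B) |: (Q :\: [set A; B]).

Lemma partition_merge (T : finType) (Q : {set {set T}}) X A B :
  partition Q X -> A \in Q -> B \in Q -> A != B ->
  partition (merge_parts Q A B) X.
Proof.
move=> pQ AQ BQ nAB; case/and3P: (pQ) => /eqP cQ tQ nQ.
have dAB Z : Z \in Q -> Z != A -> Z != B -> [disjoint A :|: B & Z].
  move=> ZQ nA nB; rewrite disjoint_sym disjoints_subset setCU subsetI.
  by rewrite -!disjoints_subset !(trivIsetP tQ).
apply/and3P; split.
- apply/eqP/setP => x; rewrite -cQ; apply/bigcupP/bigcupP => -[Z].
    rewrite !inE => /orP[/eqP->|/andP[_ ZQ]] xZ; last by exists Z.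
    by case/setUP: xZ => xZ; [exists A|exists B].
  move=> ZQ xZ; have [|nZ] := boolP (Z \in [set A; B]).
    move=> /set2P ZAB; exists (A :|: B); first by rewrite !inE eqxx.
    by rewrite inE; case: ZAB xZ => -> ->; rewrite ?orbT.
  by exists Z; rewrite // inE in_setD nZ ZQ orbT.
- apply/trivIsetP => Z W; rewrite !inE negb_or.
  case/orP=> [/eqP->|/andP[/andP[za zb] ZQ]].
    case/orP=> [/eqP->|/andP[]]; rewrite ?eqxx // negb_or.
    by move=> /andP[na nb] WQ _; apply: dAB.
  case/orP=> [/eqP-> _|]; first by rewrite disjoint_sym dAB.
  by move=> /andP[_ WQ]; apply: (trivIsetP tQ).
- rewrite !inE (negPf nQ) andbF orbF eq_sym setU_eq0 negb_and.
  by apply/orP; left; apply: contraNneq nQ => <-.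
Qed.

Lemma card_merge (T : finType) (Q : {set {set T}}) X A B :
  partition Q X -> A \in Q -> B \in Q -> A != B ->
  #|Q| = #|merge_parts Q A B|.+1.
Proof.
move=> pQ AQ BQ nAB; case/and3P: (pQ) => /eqP cQ tQ nQ.
have sAB : [set A; B] \subset Q by apply/subsetP => Z /set2P[]->.
rewrite cardsU1 (_ : _ \notin _ = true).
  by rewrite -(cardsID [set A; B] Q) (setIidPr sAB) cards2 nAB.
rewrite !inE negb_and negbK.
case: (boolP (_ \in Q)) => [UQ|_]; last by rewrite orbT.
(* If the union were already a part other than [A], it would be disjoint from [A], making [A]
   empty. *)
rewrite orbF; apply: contraT; rewrite negb_or => /andP[nA nB].
have := trivIsetP tQ _ _ UQ AQ nA; rewrite -setI_eq0 setUK => /eqP A0.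
by rewrite A0 (negPf nQ) in AQ.
Qed.

(** The bound concerns every partition but the first, which makes reflexivity unconditional; the
    first one is bounded separately in [contracts_sequence]. *)
Inductive contracts (G : sgraph) (k : nat) :
    {set {set G}} -> {set {set G}} -> Prop :=
| contracts_refl Q : contracts k Q Q
| contracts_step Q Q1 Q2 : merge_of Q Q1 -> red_component_size Q1 <= k ->
    contracts k Q1 Q2 -> contracts k Q Q2.

Lemma contracts_trans (G : sgraph) k (Q1 Q2 Q3 : {set {set G}}) :
  contracts k Q1 Q2 -> contracts k Q2 Q3 -> contracts k Q1 Q3.
Proof.
elim=> // {}Q1 Q {}Q2 m1 r1 _ IH /IH; exact: contracts_step.
Qed.

(** These are the cut neighbourhoods of single vertices, so there are at most as many of them as
    [boolcut] counts. *)
Definition types (G : sgraph) (X : {set G}) : {set {set G}} :=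
  [set nbhd [set x] :&: ~: X | x in X].

Lemma card_types_setT (G : sgraph) : #|types [set: G]| <= 1.
Proof.
apply: (@leq_trans #|[set (set0 : {set G})]|); last by rewrite cards1.
apply/subset_leq_card/subsetP => A /imsetP[y _ ->].
by rewrite setCT setI0 inE.
Qed.

(** While there are more than [m] parts, two of them have the same neighbourhood outside [X], and
    merging these keeps uniformity. Red components stay within [X], where there are at most [k]
    parts, or within [Q2]. *)
Lemma contracts_same_types (G : sgraph) (X : {set G})
    (Q1 Q2 : {set {set G}}) k m :
  #|types X| <= m -> #|Q1| <= k -> red_component_size Q2 <= k ->
  partition Q1 X -> partition Q2 (~: X) ->
  uniform_on Q1 (~: X) -> uniform_on Q2 X ->
  exists Q : {set {set G}}, [/\ partition Q X, uniform_on Q (~: X), #|Q| <= m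
    & contracts k (Q1 :|: Q2) (Q :|: Q2)].
Proof.
move=> tm k1 k2 + p2 + u2.
elim: {Q1}#|Q1| {-2}Q1 (erefl #|Q1|) k1 => [|n IH] Q1 Q1n k1 p1 u1.
  by exists Q1; split; rewrite ?Q1n //; apply: contracts_refl.
have [Q1m|mQ1] := leqP #|Q1| m.
  by exists Q1; split => //; apply: contracts_refl.
(* By uniformity this is the type shared by all vertices of the part [A]. *)
pose phi A := nbhd A :&: ~: X.
have phiE A a : A \in Q1 -> a \in A -> phi A = nbhd [set a] :&: ~: X.
  move=> AQ aA; apply/setP => v; rewrite !inE andbC [RHS]andbC.
  have [//|vX /=] := boolP (v \in X).
  apply/existsP/existsP => -[x /andP[xA xv]].
    by exists a; rewrite inE eqxx (u1 A AQ a x) // inE.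
  by move: xA; rewrite inE => /eqP xa; exists a; rewrite aA -xa.
have phi_types : phi @: Q1 \subset types X.
  apply/subsetP => _ /imsetP[A AQ ->].
  have /set0Pn [a aA] : A != set0.
    by case/and3P: p1 => _ _; apply: contraNneq => <-.
  rewrite (phiE A a) //; apply: imset_f.
  exact: (subsetP (partitionS p1 AQ)).
(* Pigeonhole: more than [m] parts, at most [m] types. *)
have : ~~ dinjectiveb phi (mem Q1).
  apply/dinjectiveP => inj; move: mQ1.
  by rewrite -(card_in_imset inj) ltnNge (leq_trans (subset_leq_card phi_types)).
case/dinjectivePn => A AQ [B /andP[nBA BQ] phiAB].
have nAB : A != B by rewrite eq_sym.
have sub1 Z : Z \in Q1 -> Z \notin Q2.
  move=> Z1; apply/negP => Z2.
  have /set0Pn [z zZ] : Z != set0.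
    by case/and3P: p1 => _ _; apply: contraNneq => <-.
  have := subsetP (partitionS p2 Z2) z zZ.
  by rewrite inE (subsetP (partitionS p1 Z1)).
have p1' := partition_merge p1 AQ BQ nAB.
have Q1'n : #|merge_parts Q1 A B| = n.
  by apply: succn_inj; rewrite -Q1n -(card_merge p1).
have u1' : uniform_on (merge_parts Q1 A B) (~: X).
  move=> Z; rewrite !inE => /orP[/eqP->|/andP[_ ZQ]]; last exact: u1.
  have phiE2 z : z \in A :|: B -> phi A = nbhd [set z] :&: ~: X.
    by move=> /setUP[zA|zB]; [exact: phiE|rewrite phiAB; exact: phiE].
  move=> a a' /phiE2 aE /phiE2; rewrite aE => /setP /[swap] v /(_ v).
  rewrite !inE andbC [in RHS]andbC => /[swap] -> /=.
  have nb1 z : [exists x in [set z], adj x v] = adj z v.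
    apply/existsP/idP => [[x /andP[/set1P-> //]]|zv].
    by exists z; rewrite inE eqxx.
  by rewrite !nb1.
have k1' : #|merge_parts Q1 A B| <= k by rewrite Q1'n -ltnS -Q1n ltnW // ltnS.
have [Q [pQ uQ Qm cQ]] := IH _ Q1'n k1' p1' u1'.
exists Q; split=> //; apply: contracts_step cQ.
- exists A, B; split; rewrite ?inE ?AQ ?BQ //.
  apply/setP => Z; rewrite !inE -!orbA; congr orb.
  rewrite andb_orr; congr orb.
  have [Z2|//] := boolP (Z \in Q2); last by rewrite andbF.
  rewrite andbT; apply/esym/negP => /orP[] /eqP ZE.
    by move: (sub1 A AQ); rewrite -ZE Z2.
  by move: (sub1 B BQ); rewrite -ZE Z2.
- apply: red_component_size_setU => //.
    exact: uniform_homogeneous p1' p2 u1' u2.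
  exact: leq_trans (red_component_size_card _) k1'.
Qed.

(* Q2 is the part of the partition outside X, left untouched while X is being
   contracted. *)
Lemma contracts_buildable (G : sgraph) m (X : {set G}) (Q2 : {set {set G}}) :
  0 < m -> buildable (fun X : {set G} => #|types X| <= m) X ->
  partition Q2 (~: X) -> uniform_on Q2 X ->
  red_component_size Q2 <= m.*2 ->
  exists Q : {set {set G}}, [/\ partition Q X, uniform_on Q (~: X), #|Q| <= m
    & contracts m.*2 (singletons X :|: Q2) (Q :|: Q2)].
Proof.
move=> m0 bX; elim: bX Q2 => {X} [x _|X Y bX IHX bY IHY dXY tXY] Q2 p2 u2 k2.
  exists (singletons [set x]); split; first exact: partition_singletons.
  - exact: uniform_on_singletons.
  - by apply: leq_trans m0; rewrite /singletons imset_set1 cards1.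
  - exact: contracts_refl.
have sXY : X \subset ~: Y by rewrite -disjoints_subset.
have sYX : Y \subset ~: X by rewrite -disjoints_subset disjoint_sym.
have mm : m <= m.*2 by rewrite -addnn leq_addr.
have dYC : [disjoint Y & ~: (X :|: Y)].
  by rewrite disjoints_subset setCK subsetUr.
have dXC : [disjoint X & ~: (X :|: Y)].
  by rewrite disjoints_subset setCK subsetUl.
have eX : Y :|: ~: (X :|: Y) = ~: X.
  apply/setP => z; rewrite !inE negb_or.
  by have [/(subsetP sYX)|_ /=] := boolP (z \in Y); rewrite ?inE ?andbT.
have eY : X :|: ~: (X :|: Y) = ~: Y.
  apply/setP => z; rewrite !inE negb_or.
  by have [/(subsetP sXY)|_ /=] := boolP (z \in X); rewrite ?inE ?andbT.
(* [X] is contracted first, with [Y] still in singletons; then [Y], with the result for [X] frozen;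
   then the parts of both, at most [m + m] of them, are merged by type. *)
have [|||QX [pX uX QXm cX]] := IHX (singletons Y :|: Q2).
- by rewrite -eX; apply: partitionU => //; apply: partition_singletons.
- apply: uniform_onU (@uniform_on_singletons _ _ _) _.
  exact: uniform_onS (subsetUl _ _) u2.
- apply: red_component_size_setU => //.
    apply: uniform_homogeneous (partition_singletons Y) p2
      (@uniform_on_singletons _ _ _) _.
    exact: uniform_onS (subsetUr _ _) u2.
  by apply: leq_trans (red_component_size_singletons _) _; apply: leq_trans mm.
have [|||QY [pY uY QYm cY]] := IHY (QX :|: Q2).
- by rewrite -eY; apply: partitionU.
- apply: uniform_onU; first exact: uniform_onS uX.
  exact: uniform_onS (subsetUr _ _) u2.
- apply: red_component_size_setU => //.
    apply: uniform_homogeneous pX p2 _ _.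
      by apply: uniform_onS uX; rewrite setCS subsetUl.
    exact: uniform_onS (subsetUl _ _) u2.
  exact: leq_trans (leq_trans (red_component_size_card _) QXm) mm.
have [|||Q [pQ uQ Qm cQ]] :=
  contracts_same_types (Q1 := QX :|: QY) tXY _ k2 _ p2 _ u2.
- by rewrite -addnn (leq_trans (leq_card_setU _ _)) // leq_add.
- exact: partitionU.
- apply: uniform_onU.
    by apply: uniform_onS uX; rewrite setCS subsetUl.
  by apply: uniform_onS uY; rewrite setCS subsetUr.
exists Q; split => //; apply: contracts_trans cQ.
rewrite singletonsU -setUA; apply: contracts_trans cX _.
by rewrite setUCA [QX :|: QY]setUC -[in X in contracts _ _ X]setUA.
Qed.

(** Each merge lowers the number of parts by exactly one, so a contraction can be indexed by that
    number, as in [partition_sequence]. *)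
Lemma contracts_sequence (G : sgraph) k (Q Q' : {set {set G}}) :
  contracts k Q Q' -> partition Q [set: G] -> red_component_size Q <= k ->
  exists P : nat -> {set {set G}}, [/\ P #|Q| = Q, P #|Q'| = Q', #|Q'| <= #|Q|,
    forall i, #|Q'| <= i <= #|Q| ->
      partition (P i) [set: G] /\ red_component_size (P i) <= k
    & forall i, #|Q'| <= i < #|Q| -> merge_of (P i.+1) (P i)].
Proof.
elim=> {Q Q'} [Q|Q Q1 Q2 mQ r1 _ IH] pQ rQ.
  exists (fun=> Q); split=> // i /andP[le1].
  by rewrite ltnNge le1.
have [A [B [AQ BQ nAB Q1E]]] := mQ.
have p1 : partition Q1 [set: G] by rewrite Q1E; apply: partition_merge.
have cQ : #|Q| = #|Q1|.+1 by rewrite Q1E; apply: card_merge pQ AQ BQ nAB.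
have [P [P1 P2 le21 Pp Pm]] := IH p1 r1.
exists (fun i => if i == #|Q| then Q else P i); split.
- by rewrite eqxx.
- by case: eqP => // E; move: le21; rewrite E cQ ltnn.
- by rewrite cQ leqW.
- move=> i /andP[le lt]; have [//|ne] := eqVneq i #|Q|.
  by apply: Pp; rewrite le -ltnS -cQ ltn_neqAle ne.
- move=> i /andP[le lt]; rewrite (ltn_eqF lt) cQ eqSS.
  have [->|ne] := eqVneq i #|Q1|; first by rewrite P1.
  by apply: Pm; rewrite le ltn_neqAle ne -ltnS -cQ.
Qed.

Lemma partition_sequence_buildable (G : sgraph) m :
  buildable (fun X : {set G} => #|types X| <= m) [set: G] ->
  exists2 P : nat -> {set {set G}}, partition_sequence P
    & partition_sequence_width P <= m.*2.
Proof.
move=> bG.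
have /set0Pn [x _] := buildable_neq0 bG.
have m0 : 0 < m.
  apply: leq_trans (buildableP bG); apply/card_gt0P.
  by exists (nbhd [set x] :&: ~: [set: G]); apply: imset_f; rewrite inE.
(* At the root nothing lies outside the cluster, so the untouched part [Q2] is empty. *)
have p0 : partition set0 (~: [set: G]).
  by rewrite setCT; apply/and3P; split; rewrite ?inE ?/cover ?big_set0 //;
    apply/trivIsetP => A; rewrite inE.
have u0 : uniform_on set0 [set: G] by move=> A; rewrite inE.
have r0 : red_component_size (set0 : {set {set G}}) <= m.*2.
  by apply: leq_trans (red_component_size_card _) _; rewrite cards0.
have [Q1 [p1 u1 Q1m c1]] := contracts_buildable m0 bG p0 u0 r0.
have tT := card_types_setT G.
have Q1mm : #|Q1| <= m.*2 by rewrite (leq_trans Q1m) // -addnn leq_addr.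
(* The whole vertex set has a single type, so a last round of merging reaches one part. *)
have [Q [pQ _ Q1' cQ]] := contracts_same_types tT Q1mm r0 p1 p0 u1 u0.
rewrite !setU0 in c1 cQ.
have QT : Q = [set [set: G]].
  have [A AQ] : exists A, A \in Q.
    case/and3P: pQ => /eqP /setP /(_ x); rewrite inE => /bigcupP[A AQ _] _ _.
    by exists A.
  have QA : Q = [set A].
    by apply/esym/eqP; rewrite eqEcard sub1set AQ cards1.
  by case/and3P: pQ => /eqP cQT _ _; move: cQT; rewrite QA /cover big_set1 => ->.
have [||P [Ps Pe _ Pp Pm]] := contracts_sequence (contracts_trans c1 cQ).
- exact: partition_singletons.
- by apply: leq_trans (red_component_size_singletons _) _; rewrite double_gt0.
have cS : #|singletons [set: G]| = #|G|.
  by rewrite /singletons card_imset ?cardsT //; apply: set1_inj.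
rewrite cS QT cards1 in Ps Pe Pp Pm.
exists P.
  split=> //; first by move=> i /Pp[].
  rewrite Ps; apply/setP => A.
  by apply/imsetP/imsetP => -[y _ ->]; exists y; rewrite ?inE.
apply/bigmax_leqP_seq => i; rewrite mem_index_iota ltnS => /Pp[]//.
Qed.

(** * From partition sequences to binary trees *)

Definition cut_nbhds (G : sgraph) (X Y : {set G}) : {set {set G}} :=
  [set nbhd S :&: Y | S in powerset X].

(** Bounding both directions makes the predicate closed under complement by definition, as rerooting
    requires. *)
Definition small_cut (G : sgraph) (k : nat) (X : {set G}) : Prop :=
  #|cut_nbhds X (~: X)| <= k /\ #|cut_nbhds (~: X) X| <= k.

Lemma small_cutC (G : sgraph) k (X : {set G}) :
  small_cut k X -> small_cut k (~: X).
Proof. by rewrite /small_cut setCK => -[]. Qed.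

Lemma small_cutS (G : sgraph) k l (X : {set G}) :
  k <= l -> small_cut k X -> small_cut l X.
Proof. by move=> kl [k1 k2]; split; apply: leq_trans kl. Qed.

(** Each neighbourhood across the cut is determined by a subfamily of [C]: for [S] inside, the parts
    that [S] meets; for [S] outside, the parts that [nbhd S] meets, each of which it contains
    entirely. *)
Lemma small_cut_uniform (G : sgraph) (C : {set {set G}}) :
  uniform_on C (~: cover C) -> small_cut (2 ^ #|C|) (cover C).
Proof.
move=> uC; have imC (f : {set {set G}} -> {set G}) :
    #|f @: powerset C| <= 2 ^ #|C|.
  by rewrite -card_powerset leq_imset_card.
split.
- apply: leq_trans (imC (fun D => \bigcup_(A in D) (nbhd A :&: ~: cover C))).
  apply/subset_leq_card/subsetP => _ /imsetP[S + ->]; rewrite inE => /subsetP SC.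
  apply/imsetP; exists [set A in C | ~~ [disjoint A & S]].
    by rewrite inE; apply/subsetP => A; rewrite inE => /andP[].
  apply/setP => v; apply/setIP/bigcupP => [[]|[A]].
    rewrite inE => /existsP[s /andP[sS sv]] vC.
    have /bigcupP[A AC sA] := SC s sS; exists A.
      rewrite inE AC; apply/negP => /disjoint_setI0/setP/(_ s).
      by rewrite !inE sA sS.
    by rewrite inE vC andbT inE; apply/existsP; exists s; rewrite sA.
  rewrite inE => /andP[AC /pred0Pn[s /andP[/= sA sS]]] /setIP[].
  rewrite inE => /existsP[a /andP[aA av]] vC; split=> //.
  by rewrite inE; apply/existsP; exists s; rewrite sS (uC A AC s a).
- apply: leq_trans (imC (@cover _)).
  apply/subset_leq_card/subsetP => _ /imsetP[S + ->]; rewrite inE => /subsetP SC.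
  apply/imsetP; exists [set A in C | ~~ [disjoint A & nbhd S]].
    by rewrite inE; apply/subsetP => A; rewrite inE => /andP[].
  apply/setP => v; apply/setIP/bigcupP => [[vS /bigcupP[A AC vA]]|[A]].
    exists A => //; rewrite inE AC; apply/negP => /disjoint_setI0/setP/(_ v).
    by rewrite in_setI vA vS inE.
  rewrite inE => /andP[AC /pred0Pn[a /andP[/= aA aS]]] vA; split; last first.
    by apply/bigcupP; exists A.
  move: aS; rewrite !inE => /existsP[s /andP[sS sa]].
  apply/existsP; exists s; rewrite sS adj_sym (uC A AC v a) ?SC //.
  by rewrite adj_sym.
Qed.

(** Such a [C] is a union of red components of [Q]. *)
Definition red_closed (G : sgraph) (Q C : {set {set G}}) : Prop :=
  C \subset Q /\ {in C, forall A, forall B, red Q A B -> B \in C}.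

Lemma red_sym (G : sgraph) (Q : {set {set G}}) : symmetric (red Q).
Proof.
by move=> A B; rewrite /red /= homogeneousC eq_sym andbCA.
Qed.

(** An outside vertex lies in a part not in [C]; were that part not homogeneous to [A], it would be
    a red neighbour of [A], hence in [C]. *)
Lemma red_closed_uniform (G : sgraph) (Q C : {set {set G}}) :
  partition Q [set: G] -> red_closed Q C -> uniform_on C (~: cover C).
Proof.
move=> pQ [/subsetP CQ clC] A AC a a' aA a'A v; rewrite inE => vC.
have vQ : v \in cover Q by rewrite (cover_partition pQ) inE.
have WQ := pblock_mem vQ; have vW : v \in pblock Q v by rewrite mem_pblock.
have WC : pblock Q v \notin C.
  by apply: contra vC => WC; apply/bigcupP; exists (pblock Q v).
have /homogeneousP : homogeneous A (pblock Q v).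
  apply: contraNT WC => nh; apply: (clC A AC); rewrite /red /= CQ // WQ nh andbT /=.
  by apply: contraNneq vC => AE; apply/bigcupP; exists A; rewrite // AE.
by apply.
Qed.

Lemma disjoint_cover (T : finType) (Q C D : {set {set T}}) :
  trivIset Q -> C \subset Q -> D \subset Q -> [disjoint C & D] ->
  [disjoint cover C & cover D].
Proof.
move=> /trivIsetP tQ /subsetP CQ /subsetP DQ dCD.
rewrite -setI_eq0; apply/eqP/setP => x; rewrite inE in_set0.
apply/negP => /andP[/bigcupP[A AC xA] /bigcupP[B BD xB]].
have nAB : A != B.
  by apply: contraTneq BD => <-; rewrite (disjointFr dCD AC).
by have := disjointFr (tQ A B (CQ _ AC) (DQ _ BD) nAB) xA; rewrite xB.
Qed.

(** The trees of the components are joined one component at a time. Each intermediate union is again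
    red-closed with at most [k] parts, so its cut is small. *)
Lemma buildable_red_closed (G : sgraph) (Q : {set {set G}}) k :
  partition Q [set: G] ->
  (forall X, X \in Q -> buildable (small_cut (2 ^ k))
     (cover [set Y in Q | connect (red Q) X Y])) ->
  forall C, red_closed Q C -> C != set0 -> #|C| <= k ->
  buildable (small_cut (2 ^ k)) (cover C).
Proof.
move=> pQ bQ C; elim: {C}#|C| {-2}C (leqnn #|C|) => [|n IH] C.
  by rewrite leqn0 cards_eq0 => ->.
move=> Cn clC /set0Pn[X XC] Ck; have [/subsetP CQ Cred] := clC.
set D := [set Y in Q | connect (red Q) X Y].
have XD : X \in D by rewrite inE CQ // connect0.
have DC : D \subset C.
  apply/subsetP => Y; rewrite inE => /andP[_]; apply: connect_invariant => //.
  by move=> a b aC; apply: Cred.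
have [CD0|CD0] := eqVneq (C :\: D) set0.
  have -> : C = D by apply/eqP; rewrite eqEsubset DC andbT -setD_eq0 CD0.
  exact/bQ/CQ.
have CE : cover C = cover D :|: cover (C :\: D).
  by rewrite -{1}(setID C D) (setIidPr DC) /cover bigcup_setU.
rewrite CE; apply: buildableU.
- exact/bQ/CQ.
- apply: IH => //.
  + rewrite -ltnS; apply: leq_trans Cn; apply: proper_card.
    rewrite properEneq subsetDl andbT; apply/eqP => /setP/(_ X).
    by rewrite in_setD XD XC.
  + split=> [|A]; first by apply: subset_trans (subsetDl _ _) _; case: clC.
    rewrite inE => /andP[nAD AC] B AB; rewrite inE (Cred A) // andbT.
    apply: contra nAD; rewrite !inE (CQ A AC) => /andP[_ XB].
    by apply: connect_trans XB (connect1 _); rewrite red_sym.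
  + by apply: leq_trans Ck; rewrite subset_leq_card // subsetDl.
- apply: (disjoint_cover (partition_trivIset pQ)).
  + by apply/subsetP => Y; rewrite inE => /andP[].
  + by apply: subset_trans (subsetDl _ _) _; case: clC.
  + by rewrite disjoint_sym disjoints_subset subsetDr.
- rewrite -CE; apply: small_cutS (small_cut_uniform (red_closed_uniform pQ clC)).
  by rewrite leq_exp2l.
Qed.

Lemma red_component_closed (G : sgraph) (Q : {set {set G}}) X :
  red_closed Q [set Y in Q | connect (red Q) X Y].
Proof.
split=> [|A]; first by apply/subsetP => Y; rewrite inE => /andP[].
rewrite inE => /andP[AQ XA] B AB; rewrite inE (connect_trans XA (connect1 AB)).
by case/and4P: AB => _ ->.
Qed.

Lemma homogeneousS (G : sgraph) (X X' Y Y' : {set G}) :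
  X' \subset X -> Y' \subset Y -> homogeneous X Y -> homogeneous X' Y'.
Proof.
move=> /subsetP sX /subsetP sY /homogeneousP H; apply/homogeneousP.
by move=> x x' /sX xX /sX x'X y y' /sY yY /sY; apply: H.
Qed.

(** [C'] consists of the parts of [Q] inside [cover C]; apart from [A] and [B] they already belong
    to [C]. Splitting a part creates no non-homogeneity, so a red edge leaving [C'] would come from
    a red edge leaving [C]. *)
Lemma red_closed_merge (G : sgraph) (Q C : {set {set G}}) A B :
  partition Q [set: G] -> A \in Q -> B \in Q -> A != B ->
  red_closed (merge_parts Q A B) C ->
  exists2 C' : {set {set G}}, red_closed Q C'
    & cover C' = cover C /\ #|C'| <= #|C|.+2.
Proof.
move=> pQ AQ BQ nAB clC; have pQ' := partition_merge pQ AQ BQ nAB.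
have [/subsetP CQ Cred] := clC.
have QQ' Z : Z \in Q -> exists2 Y, Y \in merge_parts Q A B & Z \subset Y.
  move=> ZQ; have [/set2P ZAB|nZ] := boolP (Z \in [set A; B]).
    exists (A :|: B); first by rewrite !inE eqxx.
    by case: ZAB => ->; rewrite ?subsetUl ?subsetUr.
  by exists Z; rewrite // inE in_setD nZ ZQ orbT.
have inC Y z : Y \in merge_parts Q A B -> z \in Y -> z \in cover C -> Y \in C.
  move=> YQ zY /bigcupP[Y' Y'C zY'].
  have tQ := partition_trivIset pQ'.
  by rewrite -(def_pblock tQ YQ zY) (def_pblock tQ (CQ _ Y'C) zY').
have neQ Z : Z \in Q -> exists z, z \in Z.
  by move=> /(partition_neq0 pQ)/set0Pn.
have mem_cover Y : Y \in C -> Y \subset cover C by move=> YC; apply: bigcup_sup.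
exists [set Z in Q | Z \subset cover C]; first split.
- by apply/subsetP => Z; rewrite inE => /andP[].
- move=> Z; rewrite inE => /andP[ZQ ZC] W /and4P[_ WQ nZW].
  rewrite inE WQ /=; apply: contraR => nWC.
  have [Y YQ ZY] := QQ' Z ZQ; have [V VQ WV] := QQ' W WQ.
  have [z zZ] := neQ Z ZQ.
  have YC : Y \in C by apply: inC YQ (subsetP ZY _ zZ) (subsetP ZC _ zZ).
  have VC : V \notin C.
    by apply: contra nWC => VC; apply: subset_trans WV (mem_cover _ VC).
  apply: (homogeneousS ZY WV); apply: contraNT VC => nh.
  apply: (Cred Y YC); rewrite /red /= YQ VQ nh andbT /=.
  apply: contra nWC => /eqP YV; apply: subset_trans WV _.
  by rewrite -YV mem_cover.
split.
- apply/eqP; rewrite eqEsubset; apply/andP; split.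
    by apply/bigcupsP => Z; rewrite inE => /andP[].
  apply/subsetP => z zC.
  have zQ : z \in cover Q by rewrite (cover_partition pQ) inE.
  have zZ : z \in pblock Q z by rewrite mem_pblock.
  apply/bigcupP; exists (pblock Q z) => //.
  have [Y YQ ZY] := QQ' _ (pblock_mem zQ).
  rewrite inE pblock_mem //=; apply: (subset_trans ZY); apply: mem_cover.
  exact: inC YQ (subsetP ZY _ zZ) zC.
- apply: (@leq_trans #|A |: (B |: C)|); last first.
    rewrite !cardsU1; apply: (@leq_trans (1 + (1 + #|C|))) => //.
    by rewrite leq_add ?leq_b1 // leq_add ?leq_b1.
  apply/subset_leq_card/subsetP => Z; rewrite !inE => /andP[ZQ ZC].
  have [//|nZA] := eqVneq Z A; have [//|nZB /=] := eqVneq Z B.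
  have [z zZ] := neQ Z ZQ; apply: (inC Z z) => //; last exact: (subsetP ZC).
  by rewrite !inE negb_or nZA nZB ZQ orbT.
Qed.

(** Induction along the sequence from singletons to one part. A red component has at most [d] parts,
    and undoing one merge turns it into a red-closed family with at most [d.+2], to which the
    induction hypothesis applies. *)
Lemma buildable_partition_sequence (G : sgraph) (P : nat -> {set {set G}}) :
  0 < #|G| -> partition_sequence P ->
  buildable (small_cut (2 ^ (partition_sequence_width P).+2)) [set: G].
Proof.
move=> G0 [Pp Pn P1 Pm]; set d := partition_sequence_width P.
have Pd i X : 0 < i <= #|G| -> X \in P i ->
    #|[set Y in P i | connect (red (P i)) X Y]| <= d.
  move=> iG XP; apply: (@leq_trans (red_component_size (P i))).
    by rewrite /red_component_size (bigD1 X) //= leq_maxl.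
  rewrite /d /partition_sequence_width (bigD1_seq i) ?iota_uniq //=.
    exact: leq_maxl.
  by rewrite mem_index_iota ltnS.
(* Here [i] counts the merges already made. The goal is the case [i = #|G|.-1], with the single part
   of [P 1] as [C]. *)
suff bP i : i < #|G| -> forall C, red_closed (P (#|G| - i)) C -> C != set0 ->
    #|C| <= d.+2 -> buildable (small_cut (2 ^ d.+2)) (cover C).
  have := bP #|G|.-1; rewrite ltn_predL => /(_ G0 [set [set: G]]).
  have -> : #|G| - #|G|.-1 = 1 by case: #|G| G0 => // n _; rewrite subSnn.
  rewrite /cover big_set1; apply; rewrite ?cards1 //.
    split; first by rewrite P1.
    by move=> A /set1P-> B; rewrite P1 => /and4P[].
  by apply/set0Pn; exists [set: G]; rewrite inE.
elim: i => [|i IH] iG.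
  rewrite subn0; apply: buildable_red_closed; first by rewrite Pp ?G0 ?leqnn.
  move=> X XP.
  have clX := @red_component_closed _ (P #|G|) X.
  have pG : partition (P #|G|) [set: G] by rewrite Pp ?G0 ?leqnn.
  (* Singletons are pairwise homogeneous, so the components are single parts. *)
  have XE : [set Y in P #|G| | connect (red (P #|G|)) X Y] = [set X].
    apply/setP => Y; rewrite !inE.
    apply/andP/eqP => [[_]|->]; last by rewrite connect0.
    move=> XY; apply/set1P; apply: connect_invariant XY; last by rewrite inE.
    move=> A B /set1P-> /and4P[+ + _]; rewrite Pn.
    move=> /imsetP[a _ ->] /imsetP[b _ ->] /negP[]; apply/homogeneousP.
    by move=> x x' /set1P-> /set1P-> y y' /set1P-> /set1P->.
  have := small_cut_uniform (red_closed_uniform pG clX).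
  rewrite XE cards1; move: XP; rewrite Pn => /imsetP[x _ XE'].
  rewrite /cover big_set1 XE' => sc; apply: buildable1.
  by apply: small_cutS sc; rewrite leq_exp2l.
have jG : 0 < #|G| - i.+1 < #|G|.
  by rewrite subn_gt0 iG /= ltn_subrL G0.
have jE : #|G| - i = (#|G| - i.+1).+1 by rewrite subnSK // ltnW.
have [A [B [AQ BQ nAB QE]]] := Pm _ jG.
move: IH; rewrite jE => IH; move: (Pp (#|G| - i.+1).+1) => pQ.
have {}pQ : partition (P (#|G| - i.+1).+1) [set: G].
  by apply: pQ; case/andP: jG.
have jG' : 0 < #|G| - i.+1 <= #|G| by case/andP: jG => -> /ltnW.
apply: buildable_red_closed; first exact: Pp.
move=> X XP; have Xd := Pd _ X jG' XP.
have clX := @red_component_closed _ (P (#|G| - i.+1)) X.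
move: clX Xd; set C := [set Y in _ | _] => clX Xd.
have CX : cover C != set0.
  have /set0Pn[x xX] := partition_neq0 (Pp _ jG') XP.
  by apply/set0Pn; exists x; apply/bigcupP; exists X; rewrite // inE XP connect0.
rewrite QE in clX.
have [C' clC' [C'E C'd]] := red_closed_merge pQ AQ BQ nAB clX.
rewrite -C'E.
apply: IH => //; first exact: ltnW.
- by apply: contra CX => /eqP C'0; rewrite -C'E C'0 /cover big_set0.
- by apply: leq_trans C'd _; rewrite !ltnS.
Qed.

(** * From branch decompositions to binary trees *)

Lemma del_edge_sym (T : sgraph) (x y : T) : symmetric (del_edge x y).
Proof. by move=> u v; rewrite /del_edge /= adj_sym setUC. Qed.

Lemma del_edgeC (T : sgraph) (x y : T) : del_edge x y =2 del_edge y x.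
Proof. by move=> u v; rewrite /del_edge /= [[set x; y]]setUC. Qed.

Definition cut_side (T : sgraph) (x y : T) : {set T} :=
  [set t | connect (del_edge x y) x t].

Lemma del_edge_notin (T : sgraph) (x y u v : T) :
  u != x -> v != x -> adj u v -> del_edge x y u v.
Proof.
move=> ux vx uv; rewrite /del_edge /= uv; apply/eqP => /setP/(_ x).
by rewrite !inE eqxx [x == u]eq_sym [x == v]eq_sym (negPf ux) (negPf vx).
Qed.

Lemma path_del_edge (T : sgraph) (x y a : T) p :
  x \notin a :: p -> path (@adj T) a p -> path (del_edge x y) a p.
Proof.
elim: p a => //= b p IH a; rewrite inE negb_or => /andP[xa xb] /andP[ab bp].
rewrite IH // andbT; apply: del_edge_notin => //; first by rewrite eq_sym.
by move: xb; rewrite inE negb_or eq_sym => /andP[].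
Qed.

(** * The two sides of a tree edge *)

Section Tree.
Variables (T : sgraph) (treeT : is_tree T).

(** A simple path from [x] to [y] avoiding the edge would close up with it into a cycle. The
    length-two cycle that [is_tree] permits would use the deleted edge itself. *)
Lemma tree_edge_cut (x y : T) : adj x y -> y \notin cut_side x y.
Proof.
move=> xy; rewrite inE; apply/negP => /connectP[p0 + yE].
move=> ep0; move: yE; case: (shortenP ep0) => p ep up _ yE.
have [_ _ /(_ (x :: p))] := treeT.
have adjp : path (@adj T) x p by apply: sub_path ep => u v /andP[].
have cx : ucycle (@adj T) (x :: p).
  by rewrite /ucycle up andbT /= rcons_path adjp -yE adj_sym.
move=> /(_ cx); case: p {cx adjp up} ep yE => [|z [|//]] /=.
  by move=> _ yx; move: xy; rewrite yx adj_irr.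
by move=> + zy _; rewrite -zy /del_edge /= eqxx andbF.
Qed.

(** Along a path from [x], each node stays on the side of [x] or of [y]: crossing the deleted edge
    lands on one of its ends. *)
Lemma cut_sideC (x y : T) : adj x y -> cut_side y x = ~: cut_side x y.
Proof.
move=> xy; have symc := sym_connect_sym (del_edge_sym x y).
apply/setP => t; rewrite !inE (eq_connect (del_edgeC y x)).
apply/idP/idP => [yt|].
  apply: contra (tree_edge_cut xy) => xt; rewrite inE.
  by apply: connect_trans xt _; rewrite symc.
have [_ /(_ x t) /connectP[p ep ->] _] := treeT.
suff: connect (del_edge x y) x (last x p) \/ connect (del_edge x y) y (last x p).
  by case=> [->|].
elim/last_ind: p ep => [|p z IH]; first by left; rewrite connect0.
rewrite rcons_path last_rcons => /andP[/IH {}IH zz].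
have [/eqP E|nE] := boolP ([set last x p; z] == [set x; y]).
  have /set2P : z \in [set x; y] by rewrite -E !inE eqxx orbT.
  by case=> ->; rewrite connect0; [left|right].
have st : connect (del_edge x y) (last x p) z.
  by apply: connect1; rewrite /del_edge /= zz.
by case: IH => /connect_trans/(_ st); [left|right].
Qed.

(** A walk from [a] that avoids the edge to [x] never meets [x], so it cannot use the edge [x y]
    either. The inclusion is strict because [x] is missing on the left. *)
Lemma cut_side_sub (x y a : T) :
  adj x y -> adj x a -> a != y -> cut_side a x \proper cut_side x y.
Proof.
move=> xy xa nay; have ax : adj a x by rewrite adj_sym.
have xn := tree_edge_cut ax; rewrite properE; apply/andP; split; last first.
  by apply/negP => /subsetP/(_ x); rewrite inE connect0 (negPf xn) => /(_ isT).
apply/subsetP => t; rewrite !inE => /connectP[p0 ep0 tE].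
have {ep0 tE} [p ep [tE xp]] : exists2 p, path (@adj T) a p
    & last a p = t /\ x \notin a :: p.
  exists p0; first by apply: sub_path ep0 => u v /andP[].
  split=> //; apply: contra xn => xp; rewrite inE.
  exact: (path_connect ep0).
apply: (@connect_trans _ _ a).
  apply: connect1; rewrite /del_edge /= xa; apply/eqP => /setP/(_ a).
  rewrite !inE eqxx orbT (negPf nay) orbF => /esym/eqP ae.
  by rewrite ae adj_irr in xa.
by apply/connectP; exists p; [exact: path_del_edge|].
Qed.

Lemma cut_sideP (x y t : T) : adj x y -> t \in cut_side x y -> t != x ->
  exists2 a, adj x a /\ a != y & t \in cut_side a x.
Proof.
move=> xy; rewrite inE => /connectP[p0 ep0 ->]; case: (shortenP ep0).
move=> [|a p] /=; first by rewrite eqxx.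
move=> /andP[/andP[xa nE] ep] /andP[xp up] _ _; exists a.
  by split=> //; apply: contraNneq nE => ->.
rewrite inE (eq_connect (del_edgeC a x)); apply/connectP; exists p => //.
by apply: path_del_edge => //; apply: sub_path ep => u v /andP[].
Qed.

Lemma cut_side_disjoint (x a b : T) : adj x a -> adj x b -> a != b ->
  [disjoint cut_side a x & cut_side b x].
Proof.
move=> xa xb nab; have bx : adj b x by rewrite adj_sym.
have := cut_side_sub xb xa nab; rewrite (cut_sideC bx) => /proper_sub.
by rewrite disjoints_subset.
Qed.

End Tree.

Section BranchDecomposition.
Variables (G : sgraph) (D : branch_decomposition G).
Let treeD := bd_treeP D.

Lemma in_bd_side (x y : bd_tree D) v :
  (v \in bd_side x y) = (bd_leaf D v \in cut_side x y).
Proof. by rewrite !inE. Qed.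

Lemma bd_sideE (x y : bd_tree D) : bd_side x y = bd_leaf D @^-1: cut_side x y.
Proof. by apply/setP => v; rewrite !inE. Qed.

Lemma bd_sideC (x y : bd_tree D) : adj x y -> bd_side y x = ~: bd_side x y.
Proof. by move=> xy; rewrite !bd_sideE (cut_sideC treeD xy) preimsetC. Qed.

(** Induction on the number of tree nodes on the side of [x]. A leaf [x] has no neighbour but [y]
    and gives a singleton; an internal [x] has two further neighbours, whose sides partition its
    own. *)
Lemma buildable_bd_side (P : {set G} -> Prop) :
  (forall x y : bd_tree D, adj x y -> P (bd_side x y)) ->
  forall x y : bd_tree D, adj x y -> buildable P (bd_side x y).
Proof.
move=> PD x y; move: {2}#|_| (leqnn #|cut_side x y|) => n.
elim: n x y => [|n IH] x y.
  rewrite leqn0 cards_eq0 => /eqP/setP/(_ x).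
  by rewrite !inE connect0.
move=> cn xy; set N := [set a | adj x a].
have yN : y \in N by rewrite inE.
have [/[dup] x1|x1] := boolP (degree x <= 1).
  rewrite -bd_leafP => /codomP[v xv].
  suff E : bd_side x y = [set v] by move: (PD x y xy); rewrite E; apply: buildable1.
  have NE : N = [set y].
    by apply/esym/eqP; rewrite eqEcard sub1set yN cards1.
  apply/setP => w; rewrite in_bd_side in_set1; apply/idP/eqP => [|->]; last first.
    by rewrite -xv inE connect0.
  have [/eqP|wx wc] := boolP (bd_leaf D w == x).
    by rewrite xv => /bd_leaf_inj.
  have [a [xa nay] _] := cut_sideP xy wc wx.
  by have : a \in N; [rewrite inE|rewrite NE inE (negPf nay)].
rewrite -ltnNge in x1; have N3 := bd_internal x1.
have xl v : bd_leaf D v != x.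
  apply: contraTneq x1 => <-; rewrite -leqNgt -bd_leafP; exact: codom_f.
have : #|N :\ y| == 2.
  by move: N3; rewrite /degree -/N (cardsD1 y) yN add1n => -[->].
case/cards2P => a [b [nab NE]].
have Nin c : c \in [set a; b] -> adj x c /\ c != y.
  by rewrite -NE !inE => /andP[].
have [xa nay] : adj x a /\ a != y by apply: Nin; rewrite !inE eqxx.
have [xb nby] : adj x b /\ b != y by apply: Nin; rewrite !inE eqxx orbT.
have bc c : adj x c -> c != y -> buildable P (bd_side c x).
  move=> xc ncy; apply: IH; last by rewrite adj_sym.
  by rewrite -ltnS; apply: leq_trans cn; apply/proper_card/cut_side_sub.
have E : bd_side x y = bd_side a x :|: bd_side b x.
  apply/setP => v; rewrite in_setU !in_bd_side; apply/idP/orP.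
    move=> vxy; have [c [xc ncy] vc] := cut_sideP xy vxy (xl v).
    have : c \in [set a; b] by rewrite -NE !inE ncy.
    by case/set2P => cE; [left|right]; rewrite -cE.
  by case; apply/subsetP/proper_sub/cut_side_sub.
have PU := PD x y xy; rewrite E in PU *; apply: buildableU PU; [exact: bc|exact: bc|].
rewrite !bd_sideE -setI_eq0 -preimsetI.
by rewrite (disjoint_setI0 (cut_side_disjoint treeD xa xb nab)) preimset0.
Qed.

Lemma buildable_branch_decomposition (P : {set G} -> Prop) :
  1 < #|G| -> P [set: G] ->
  (forall x y : bd_tree D, adj x y -> P (bd_side x y)) -> buildable P [set: G].
Proof.
move=> G1 PT PD.
have /card_gt1P [v [w [_ _ nvw]]] := G1.
(* The root is placed on an edge at a leaf; one exists since two distinct leaves are connected. *)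
have [x xN] : exists y, adj (bd_leaf D v) y.
  have [_ /(_ (bd_leaf D v) (bd_leaf D w)) /connectP[p ep wE] _] := treeD.
  case: p ep wE => [_ /bd_leaf_inj wv|y p /= /andP[vy _] _]; last by exists y.
  by rewrite wv eqxx in nvw.
have E : [set: G] = bd_side (bd_leaf D v) x :|: bd_side x (bd_leaf D v).
  by rewrite (bd_sideC xN) setUCr.
rewrite E in PT *; apply: buildableU PT.
- exact: buildable_bd_side.
- by apply: buildable_bd_side; rewrite // adj_sym.
- by rewrite (bd_sideC xN) disjoints_subset setCK.
Qed.

End BranchDecomposition.

(** * From binary trees to branch decompositions *)

Definition laminar (T : finType) (F : {set {set T}}) : Prop :=
  {in F &, forall A B : {set T}, [|| A \subset B, B \subset A | [disjoint A & B]]}.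

Definition splits (T : finType) (F : {set {set T}}) (Z A B : {set T}) : Prop :=
  [/\ A \in F, B \in F, [disjoint A & B] & Z = A :|: B].

(** The set of all clusters of the tree. Clusters from different subtrees are disjoint, and this
    finite set carries enough data to define a graph. *)
Lemma buildable_laminar (T : finType) (P : {set T} -> Prop) X :
  buildable P X -> exists F : {set {set T}},
    [/\ X \in F /\ laminar F,
        {in F, forall Z : {set T}, [/\ Z \subset X, Z != set0 & P Z]},
        {in X, forall x, [set x] \in F}
      & {in F, forall Z : {set T},
           (exists x, Z = [set x]) \/ exists A B, splits F Z A B}].
Proof.
elim=> {X} [x Px|X Y bX [F1 [[XF1 l1] s1 x1 sp1]] bY
  [F2 [[YF2 l2] s2 x2 sp2]] dXY PXY].
  exists [set [set x]]; split.
  - by split; [rewrite inE|move=> A B /set1P-> /set1P->; rewrite subxx].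
  - by move=> Z /set1P->; split=> //; apply/set0Pn; exists x; rewrite inE.
  - by move=> y /set1P->; rewrite inE.
  - by move=> Z /set1P->; left; exists x.
have spU Z (F' : {set {set T}}) : F' \subset F1 :|: F2 ->
    (exists x, Z = [set x]) \/ (exists A B, splits F' Z A B) ->
    (exists x, Z = [set x]) \/
    (exists A B, splits ((X :|: Y) |: (F1 :|: F2)) Z A B).
  move=> /subsetP sF [|[A [B [AF BF dAB ->]]]]; first by left.
  by right; exists A, B; split=> //; rewrite inE sF ?orbT.
exists ((X :|: Y) |: (F1 :|: F2)).
have sub Z : Z \in (X :|: Y) |: (F1 :|: F2) ->
    [/\ Z \subset X :|: Y, Z != set0 & P Z].
  rewrite !inE => /or3P[/eqP->|/s1[sZ nZ PZ]|/s2[sZ nZ PZ]]; split=> //.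
  - by rewrite setU_eq0 negb_and (buildable_neq0 bX).
  - exact: subset_trans sZ (subsetUl _ _).
  - exact: subset_trans sZ (subsetUr _ _).
have d12 A B : A \in F1 -> B \in F2 -> [disjoint A & B].
  by move=> /s1[sA _ _] /s2[sB _ _]; apply: disjointW sA sB dXY.
split=> //.
- split; first by rewrite !inE eqxx.
  move=> A B AF BF; have [sA _ _] := sub A AF; have [sB _ _] := sub B BF.
  move: AF BF; rewrite !inE => /or3P[/eqP->|A1|A2]; first by rewrite sB orbT.
    case/or3P=> [/eqP->|B1|B2]; [by rewrite sA|exact: l1|].
    by rewrite (d12 A B) // !orbT.
  case/or3P=> [/eqP->|B1|B2]; [by rewrite sA| |exact: l2].
  by rewrite [X in [|| _, _ | X]]disjoint_sym (d12 B A) // !orbT.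
- by move=> x; rewrite !inE => /orP[/x1|/x2] ->; rewrite ?orbT.
- move=> Z; rewrite !inE => /or3P[/eqP->|/sp1 sp|/sp2 sp].
  + by right; exists X, Y; split; rewrite // !inE ?XF1 ?YF2 ?orbT.
  + by apply: spU sp; apply: subsetUl.
  + by apply: spU sp; apply: subsetUr.
Qed.

(** * The covering graph of a laminar family *)

Section LaminarTree.
Variables (G : sgraph) (v0 : G) (F : {set {set G}}).
Hypotheses (topF : [set~ v0] \in F) (lamF : laminar F)
  (subF : {in F, forall Z : {set G}, Z \subset [set~ v0] /\ Z != set0})
  (singF : {in [set~ v0], forall x, [set x] \in F})
  (splitF : {in F, forall Z : {set G},
     (exists x, Z = [set x]) \/ exists A B, splits F Z A B}).

(* The node [set: G] stands for the leaf v0, at which the tree is rooted. *)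
Let N := [set: G] |: F.

Let sFN Z : Z \in F -> Z \in N. Proof. by move=> ZF; rewrite inE ZF orbT. Qed.

Let TN : [set: G] \in N. Proof. by rewrite !inE eqxx. Qed.

Let NP Z : Z \in N -> Z = [set: G] \/ Z \in F.
Proof. by rewrite in_setU1 => /orP[/eqP|]; [left|right]. Qed.

Let neN Z : Z \in N -> exists z, z \in Z.
Proof. by case/NP => [->|/subF[_ /set0Pn]//]; exists v0; rewrite inE. Qed.

Let neTF Z : Z \in F -> v0 \notin Z.
Proof. by move=> /subF[/subsetP sZ _]; apply/negP => /sZ; rewrite !inE eqxx. Qed.

Let nested X Y z : X \in N -> Y \in N -> z \in X -> z \in Y ->
  X \subset Y \/ Y \subset X.
Proof.
case/NP=> [->|XF]; first by rewrite subsetT; right.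
case/NP=> [->|YF] zX zY; first by rewrite subsetT; left.
have /or3P[] := lamF XF YF; [by left|by right|].
by move/disjointFr/(_ zX); rewrite zY.
Qed.

(** The covering relation of inclusion on [N]: [Y] is the parent of [X]. *)
Definition covered_by (X Y : {set G}) : bool :=
  (X \proper Y) && [forall W in N, ~~ ((X \proper W) && (W \proper Y))].

Let cov_proper X Y : covered_by X Y -> X \proper Y.
Proof. by case/andP. Qed.

(** Members of [N] sharing a point are nested, so those strictly above [X] form a chain and the
    parent is its least element. *)
Let cov_sub X Y W : X \in N -> Y \in N -> W \in N ->
  covered_by X Y -> X \proper W -> Y \subset W.
Proof.
move=> XN YN WN /andP[XY /forall_inP cXY] XW.
have [z zX] := neN XN.
have [//|WY] := nested YN WN (subsetP (proper_sub XY) _ zX)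
  (subsetP (proper_sub XW) _ zX).
by have := cXY W WN; rewrite XW properE WY /= negbK.
Qed.

Let cov_uniq X Y Y' : X \in N -> Y \in N -> Y' \in N ->
  covered_by X Y -> covered_by X Y' -> Y = Y'.
Proof.
move=> XN YN Y'N cY cY'; apply/eqP; rewrite eqEsubset.
by rewrite (cov_sub XN YN Y'N cY (cov_proper cY'))
  (cov_sub XN Y'N YN cY' (cov_proper cY)).
Qed.

Let cov_exists X : X \in N -> X != [set: G] -> exists2 Y, Y \in N & covered_by X Y.
Proof.
move=> XN XT; have XTp : X \proper [set: G] by rewrite properEneq XT subsetT.
case: (@arg_minnP _ [set: G] [pred Y | (Y \in N) && (X \proper Y)]
  (fun Y => #|Y|)) => /=.
  by rewrite TN.
move=> Y /andP[YN XY] minY; exists Y => //; rewrite /covered_by XY.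
apply/forall_inP => W WN; apply/negP => /andP[XW WY].
by have := minY W; rewrite WN XW leqNgt proper_card // => /(_ isT).
Qed.

(** By laminarity, a [W] inside neither half and disjoint from neither would contain both, hence all
    of [Z]. It follows that the children of [Z] are exactly [A] and [B]. *)
Let sub_split Z A B W : splits F Z A B -> W \in N -> W \proper Z ->
  W \subset A \/ W \subset B.
Proof.
move=> [AF BF dAB ZE] WN WZ; have WT : W != [set: G].
  by apply: contraTneq WZ => ->; rewrite properE subsetT andbF.
have WF : W \in F by case/NP: WN WT => // ->; rewrite eqxx.
have WAB : W \subset A :|: B by rewrite -ZE proper_sub.
have case1 C D : A :|: B = C :|: D -> [disjoint W & C] -> W \subset D.
  move=> E WC; apply/subsetP => w wW; have := subsetP WAB w wW.
  by rewrite E inE (disjointFr WC wW).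
have /or3P[?|AW|/(case1 _ B erefl)] := lamF WF AF; [by left| |by right].
have /or3P[?|BW|/(case1 _ A (setUC _ _))] := lamF WF BF; [by right| |by left].
by have := proper_subn WZ; rewrite ZE subUset AW BW.
Qed.

Let splitsC Z A B : splits F Z A B -> splits F Z B A.
Proof. by case=> AF BF dAB ->; split; rewrite // 1?disjoint_sym // setUC. Qed.

Let cov_split Z A B : splits F Z A B -> covered_by A Z.
Proof.
move=> sp; have [AF BF dAB ZE] := sp.
have [[a aA] [b bB]] := (neN (sFN AF), neN (sFN BF)).
have AZ : A \proper Z.
  rewrite ZE properE subsetUl; apply/subsetPn; exists b.
    by rewrite inE bB orbT.
  by rewrite (disjointFl dAB bB).
rewrite /covered_by AZ; apply/forall_inP => W WN; apply/negP => /andP[AW WZ].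
have [WA|WB] := sub_split sp WN WZ; first by rewrite properE WA andbF in AW.
have := subsetP WB a (subsetP (proper_sub AW) a aA).
by rewrite (disjointFr dAB aA).
Qed.

Let split_cov Z A B W : splits F Z A B -> W \in N -> covered_by W Z ->
  W = A \/ W = B.
Proof.
move=> sp WN cW.
have aux A' B' : splits F Z A' B' -> W \subset A' -> W = A'.
  move=> sp' WA; apply/eqP; apply: contraT => nWA; have [A'F _ _ _] := sp'.
  have WA' : W \proper A' by rewrite properEneq nWA.
  case/andP: cW => _ /forall_inP/(_ _ (sFN A'F)).
  by rewrite WA' cov_proper ?(cov_split sp').
case: (sub_split sp WN (cov_proper cW)) => [/(aux _ _ sp)|/(aux _ _ (splitsC sp))].
  by left.
by right.
Qed.

Let cov_top W : W \in N -> covered_by W [set: G] -> W = [set~ v0].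
Proof.
move=> WN /andP[WT /forall_inP cW].
have WF : W \in F.
  by case/NP: WN WT => // ->; rewrite properE subxx.
have [WX _] := subF WF; apply/eqP; apply: contraT => nW.
have := cW _ (sFN topF); rewrite properEneq nW WX /= properT.
by move/negPn/eqP/setP/(_ v0); rewrite !inE eqxx.
Qed.

Let cov_sing W x : W \in N -> ~~ covered_by W [set x].
Proof.
move=> WN; apply/negP => /cov_proper; rewrite properEcard cards1 ltnS leqn0.
rewrite cards_eq0 => /andP[_ /eqP W0]; have [z] := neN WN.
by rewrite W0 inE.
Qed.

Definition laminar_node : finType := {Z : {set G} | Z \in N}.

Definition laminar_adj : rel laminar_node :=
  [rel X Y | covered_by (val X) (val Y) || covered_by (val Y) (val X)].

Fact laminar_adj_sym : symmetric laminar_adj.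
Proof. by move=> X Y; rewrite /laminar_adj /= orbC. Qed.

Fact laminar_adj_irr : irreflexive laminar_adj.
Proof. by move=> X; rewrite /laminar_adj /= orbb /covered_by properxx. Qed.

Definition laminar_tree : sgraph := SGraph laminar_adj_sym laminar_adj_irr.

Let node Z (ZN : Z \in N) : laminar_tree := Sub Z ZN.

Let nodeN (X : laminar_tree) : val X \in N. Proof. exact: valP. Qed.

(** Climbing from parent to parent ends at [R], as clusters strictly grow. [e] and [Q] are left
    general to serve both for the whole tree and for one side of a deleted edge. *)
Let up (e : rel laminar_tree) (Q : pred {set G}) (R : laminar_tree) :
  (forall X : laminar_tree, Q (val X) -> X = R \/
     exists Y : laminar_tree, [/\ covered_by (val X) (val Y), Q (val Y) & e X Y]) ->
  forall X : laminar_tree, Q (val X) -> connect e X R.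
Proof.
move=> H X; move: {2}#|_| (leqnn #|~: val X|) => n; elim: n X => [|n IH] X Xn QX.
  have [->|[Y [/cov_proper XY _ _]]] := H X QX; first exact: connect0.
  move: XY; rewrite properE => /andP[_ /subsetPn[z _ zX]].
  by move: Xn; rewrite leqn0 cards_eq0 => /eqP/setP/(_ z); rewrite !inE zX.
have [->|[Y [/cov_proper XY QY eXY]]] := H X QX; first exact: connect0.
apply: connect_trans (connect1 eXY) _; apply: IH => //.
by rewrite -ltnS; apply: leq_trans Xn; rewrite proper_card // properC.
Qed.

Let parent (X : laminar_tree) : val X != [set: G] ->
  exists Y : laminar_tree, covered_by (val X) (val Y).
Proof. by move=> /(cov_exists (nodeN X))[Y YN]; exists (node YN). Qed.

Let root : laminar_tree := node TN.

Lemma laminar_tree_is_tree : is_tree laminar_tree.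
Proof.
have upT X : connect (@adj laminar_tree) X root.
  apply: (up (Q := predT)) => // {}X _; have [XT|XT] := eqVneq (val X) [set: G].
    by left; apply: val_inj.
  right; have [Y XY] := parent XT; exists Y; split=> //.
  by rewrite /= /laminar_adj /= XY.
split.
- by apply/card_gt0P; exists root.
- move=> X Y; apply: connect_trans (upT X) _.
  by rewrite (sym_connect_sym (@adj_sym laminar_tree)).
- move=> c /andP[cyc uc]; have [//|c2] := leqP (size c) 2.
  (* Both neighbours on a cycle of its smallest cluster must be the unique
     cluster covering it. *)
  have [X0 X0c] : exists X0, X0 \in c.
    by case: c c2 {cyc uc} => // X0 c _; exists X0; rewrite inE eqxx.
  case: (@arg_minnP _ X0 (mem c) (fun X : laminar_tree => #|val X|) X0c) => X Xc minX.
  have covX Y : Y \in c -> adj X Y -> covered_by (val X) (val Y).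
    move=> Yc /orP[//|/cov_proper/proper_card]; by rewrite ltnNge minX.
  have [i p cE] := rot_to Xc.
  have memc Y : Y \in X :: p -> Y \in c by rewrite -cE mem_rot.
  have {}cyc : cycle (@adj laminar_tree) (X :: p) by rewrite -cE rot_cycle.
  have {uc} : uniq (X :: p) by rewrite -cE rot_uniq.
  have: 2 < size (X :: p) by rewrite -cE size_rot.
  case: p cyc memc {cE} => [|Y [|Z p]] // + memc _.
  rewrite [cycle _ _]/= rcons_path => /andP[XY /andP[_ /andP[_ lX]]].
  have {}lX : @adj laminar_tree X (last Z p) by rewrite adj_sym.
  have lc : last Z p \in Z :: p by apply: mem_last.
  have YE : Y = last Z p.
    apply: val_inj; apply: (cov_uniq (nodeN X)) => //.
      by apply: covX XY; apply: memc; rewrite !inE eqxx orbT.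
    by apply: covX lX; apply: memc; rewrite in_cons in_cons lc !orbT.
  by move=> /= /and3P[_]; rewrite YE lc.
Qed.

Let leafset (v : G) : {set G} := if v == v0 then [set: G] else [set v].

Let leafset_in v : leafset v \in N.
Proof.
by rewrite /leafset; case: eqP => // /eqP nv; apply/sFN/singF; rewrite !inE.
Qed.

Let leaf v : laminar_tree := node (leafset_in v).

Let leaf_inj : injective leaf.
Proof.
move=> u v /(congr1 val) /=; rewrite /leafset.
case: eqP => [->|nu]; case: eqP => [->|nv] //; last exact: set1_inj.
  by move/setP/(_ v0); rewrite !inE => /esym/eqP.
by move/setP/(_ v0); rewrite !inE => /eqP.
Qed.

Let nodeP (X : laminar_tree) :
  (exists v, X = leaf v) \/ exists A B, splits F (val X) A B.
Proof.
case: (NP (nodeN X)) => [XT|XF].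
  by left; exists v0; apply: val_inj; rewrite /= /leafset eqxx.
have [[x Xx]|] := splitF XF; last by right.
left; exists x; apply: val_inj; rewrite /= /leafset ifN //.
by apply: contraTneq (neTF XF) => xE; rewrite Xx xE inE eqxx.
Qed.

(** The root [[set: G]] has the single child [[set~ v0]]; a singleton has no child and one
    parent. *)
Let degree_leaf v : degree (leaf v) <= 1.
Proof.
apply/card_le1_eqP => X Y; rewrite !inE /= /laminar_adj /=.
rewrite /leafset; case: eqP => [_|/eqP nv].
  have nT Z : covered_by [set: G] Z = false.
    by apply/negP => /cov_proper; rewrite properE subsetT andbF.
  rewrite !nT /= => /(cov_top (nodeN X)) XE /(cov_top (nodeN Y)) YE.
  by apply: val_inj; rewrite XE YE.
rewrite (negPf (cov_sing v (nodeN X))) (negPf (cov_sing v (nodeN Y))) !orbF.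
move=> cX cY; apply: val_inj.
by apply: (cov_uniq _ (nodeN Y) (nodeN X) cY cX); apply/sFN/singF; rewrite !inE.
Qed.

(** The three neighbours are the children [A] and [B] and the parent, which exists since [v0] is not
    in [val X]. *)
Let degree_split (X : laminar_tree) A B : splits F (val X) A B -> degree X = 3.
Proof.
move=> sp; have [AF BF dAB XE] := sp; have spC := splitsC sp.
have XT : val X != [set: G].
  apply: contraTneq (subsetT [set v0]) => XT; rewrite sub1set -XT XE inE.
  by rewrite (negPf (neTF AF)) (negPf (neTF BF)).
have [Y XY] := parent XT.
have nAB : A != B.
  apply: contraTneq dAB => <-; have [a aA] := neN (sFN AF).
  by apply/negP => /disjointFr/(_ aA); rewrite aA.
have pA := cov_proper (cov_split sp); have pB := cov_proper (cov_split spC).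
have pY := cov_proper XY.
pose nA : laminar_tree := node (sFN AF); pose nB : laminar_tree := node (sFN BF).
have eqN (Z W : laminar_tree) : (Z == W) = (val Z == val W) by rewrite val_eqE.
have -> : degree X = #|[set nA; nB; Y]|.
  apply: eq_card => Z; rewrite !inE /= /laminar_adj /= orbC !eqN /=.
  apply/orP/idP => [[cZ|cZ]|].
  - by case: (split_cov sp (nodeN Z) cZ) => ->; rewrite eqxx ?orbT.
  - by rewrite (cov_uniq (nodeN X) (nodeN Z) (nodeN Y) cZ XY) eqxx orbT.
  - case/orP=> [/orP[]|] /eqP->; [left|left|by right].
      exact: cov_split sp.
    exact: cov_split spC.
have nYA : Y \notin [set nA; nB].
  rewrite !inE negb_or !eqN /=; apply/andP; split.
    by apply: contraTneq (proper_trans pA pY) => E; rewrite /= E properxx.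
  by apply: contraTneq (proper_trans pB pY) => E; rewrite /= E properxx.
by rewrite setUC cardsU1 nYA cards2 eqN /= nAB.
Qed.

Fact laminar_leafP (t : laminar_tree) : (t \in codom leaf) = (degree t <= 1).
Proof.
case: (nodeP t) => [[v ->]|[A [B sp]]]; first by rewrite codom_f degree_leaf.
rewrite (degree_split sp); apply/negP => /codomP[v tE].
by have := degree_leaf v; rewrite -tE (degree_split sp).
Qed.

Fact laminar_internal (t : laminar_tree) : 1 < degree t -> degree t = 3.
Proof.
case: (nodeP t) => [[v ->]|[A [B sp]]]; last by rewrite (degree_split sp).
by rewrite ltnNge degree_leaf.
Qed.

Definition laminar_decomposition : branch_decomposition G :=
  BranchDecomposition laminar_tree_is_tree leaf_inj laminar_leafP
    laminar_internal.

(** Once the edge to the parent is deleted, [X] reaches exactly the clusters it contains, and the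
    leaf of [v] is one of them when [v] is in [val X]. *)
Lemma laminar_bd_side (X Y : laminar_tree) : covered_by (val X) (val Y) ->
  bd_side (X : bd_tree laminar_decomposition) Y = val X.
Proof.
move=> XY; have XT : val X != [set: G].
  by apply: contraTneq (cov_proper XY) => ->; rewrite properE subsetT andbF.
have XF : val X \in F by case/NP: (nodeN X) XT => // ->; rewrite eqxx.
have down (Z : laminar_tree) :
    connect (@del_edge laminar_tree X Y) X Z = (val Z \subset val X).
  apply/idP/idP => [cZ|ZX].
    suff: Z \in [set W : laminar_tree | val W \subset val X] by rewrite inE.
    apply: connect_invariant cZ; last by rewrite inE.
    move=> V W; rewrite !inE => VX /andP[/orP[VW|WV] nE]; last first.
      exact: subset_trans (proper_sub (cov_proper WV)) VX.
    (* An upward step leaves the subtree only from [X] itself, and that step is the deleted edge. *)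
    have [VE|VE] := eqVneq (val V) (val X).
      have WE : val W = val Y by apply: cov_uniq (nodeN X) _ _ _ XY; rewrite // -VE.
      by move: nE; rewrite (val_inj VE) (val_inj WE) eqxx.
    by apply: (cov_sub _ _ _ VW); rewrite ?properEneq ?VE.
  rewrite (sym_connect_sym (del_edge_sym _ _)).
  apply: (up (Q := fun W => W \subset val X)) ZX => W WX.
  have [WE|WE] := eqVneq (val W) (val X); first by left; apply: val_inj.
  have WpX : val W \proper val X by rewrite properEneq WE.
  have [|V WV] := @parent W.
    by apply: contraTneq WpX => ->; rewrite properE subsetT andbF.
  right; exists V; split=> //; first exact: (cov_sub _ _ _ WV).
  rewrite /del_edge /= /laminar_adj /= WV /=; apply/eqP => /setP/(_ W).
  rewrite !inE eqxx /= => /esym/orP[]/eqP E; first by rewrite E eqxx in WE.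
  by have := proper_trans WpX (cov_proper XY); rewrite E properxx.
apply/setP => v; rewrite inE down /= /leafset; case: eqP => [->|_].
  by rewrite subTset (negPf XT) (negPf (neTF XF)).
by rewrite sub1set.
Qed.

End LaminarTree.

(** Each edge joins a cluster to its parent, so its two sides are the cluster and its complement. *)
Lemma branch_decomposition_buildable (G : sgraph) (P : {set G} -> Prop) :
  1 < #|G| -> (forall X, P X -> P (~: X)) -> buildable P [set: G] ->
  exists D : branch_decomposition G,
    forall x y : bd_tree D, adj x y -> P (bd_side x y).
Proof.
move=> G1 PC bG; have /card_gt0P [v0 _] := ltnW G1.
have [F [[topF lamF] subF singF splitF]] :=
  buildable_laminar (buildable_setC1 v0 PC G1 bG).
have subF' : {in F, forall Z : {set G}, Z \subset [set~ v0] /\ Z != set0}.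
  by move=> Z /subF[].
exists (laminar_decomposition topF lamF subF' singF splitF) => X Y XY.
have [cXY|cYX] := orP XY.
  rewrite (laminar_bd_side topF lamF subF' singF splitF cXY).
  have [] := setU1P (valP X); last by move=> /subF[].
  by move=> XT; case/andP: cXY; rewrite XT properE subsetT andbF.
rewrite bd_sideC; last by rewrite adj_sym.
rewrite (laminar_bd_side topF lamF subF' singF splitF cYX); apply: PC.
have [] := setU1P (valP Y); last by move=> /subF[].
by move=> XT; case/andP: cYX; rewrite XT properE subsetT andbF.
Qed.

(** * Boolean-width and component twin-width *)

Import Order.TTheory GRing.Theory Num.Theory.

(** * Attained minima and the widths *)

Lemma minimum_default (d : Order.disp_t) (T : porderType d) (x0 : T) A :
  ~ (exists x, A x) -> minimum x0 A = x0.
Proof.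
move=> nA; apply: classical_sets.xgetPN => x [Ax _].
by apply: nA; exists x.
Qed.

Lemma minimumP (d : Order.disp_t) (T : porderType d) (x0 : T)
    (A : classical_sets.set T) :
  (exists m, A m /\ forall x, A x -> (m <= x)%O) ->
  A (minimum x0 A) /\ forall x, A x -> (minimum x0 A <= x)%O.
Proof. by move=> exA; apply: (classical_sets.xgetPex x0 exA). Qed.

(** A set of reals may lack a least element; one with finitely many possible values does not. The
    induction drops the head of the list and then compares with it. *)
Lemma ex_minimum_seq (d : Order.disp_t) (T : orderType d)
    (A : classical_sets.set T) (s : seq T) :
  (exists x, A x) -> (forall x, A x -> x \in s) ->
  exists m, A m /\ forall x, A x -> (m <= x)%O.
Proof.
elim: s A => [|a s IH] A [x Ax] sA; first by have := sA x Ax.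
have [[y [Ay ya]]|nA] := boolp.pselect (exists y, A y /\ y != a); last first.
  exists x; split=> // y Ay.
  have xa z : A z -> z = a.
    by move=> Az; apply/eqP; apply: contraT => za; case: nA; exists z.
  by rewrite (xa x Ax) (xa y Ay).
have [|z [Az za]|m [[Am ma] minm]] := IH (fun z => A z /\ z != a).
- by exists y.
- by have := sA z Az; rewrite inE (negPf za).
have [Aa|nAa] := boolp.pselect (A a); last first.
  exists m; split=> // z Az; apply: minm; split=> //.
  by apply/eqP => zE; rewrite zE in Az.
exists (Order.min m a); split; first by case: (leP m a).
move=> z Az; rewrite ge_min; have [->|za] := eqVneq z a.
  by rewrite lexx orbT.
by rewrite minm.
Qed.

Lemma ltwwP (G : sgraph) :
  (exists P : nat -> {set {set G}}, partition_sequence P) ->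
  (exists2 P : nat -> {set {set G}}, partition_sequence P
     & ltww G = partition_sequence_width P) /\
  forall P : nat -> {set {set G}}, partition_sequence P ->
    ltww G <= partition_sequence_width P.
Proof.
move=> [P0 P0s]; rewrite /ltww; set A := (fun k : nat => _).
have exA : exists m, A m /\ forall x, A x -> (m <= x)%O.
  have exb : exists k, boolp.asbool (A k).
    by exists (partition_sequence_width P0); apply/boolp.asboolP; exists P0.
  case: (ex_minnP exb) => m /boolp.asboolP Am minm; exists m; split=> // x Ax.
  by apply: minm; apply/boolp.asboolP.
have [[P [Ps PE]] minP] := minimumP 0 exA.
split; first by exists P.
by move=> Q Qs; apply: minP; exists Q.
Qed.

Section BooleanWidth.
Local Open Scope ring_scope.
Variable R : realType.

Lemma boolcut_le (G : sgraph) (X Y : {set G}) (n : nat) :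
  (boolcut R X Y <= n%:R) = (#|cut_nbhds X Y| <= 2 ^ n)%N.
Proof.
(* Comparing logarithms requires a positive count; [S = set0] provides one neighbourhood. *)
have c0 : (0 < #|cut_nbhds X Y|)%N.
  apply/card_gt0P; exists (nbhd set0 :&: Y); apply: imset_f.
  by rewrite inE sub0set.
rewrite /boolcut -/(cut_nbhds X Y) /log2 ler_pdivrMr; last first.
  by rewrite exp.ln_gt0 // ltr1n.
rewrite mulr_natl -exp.lnXn // exp.ler_ln ?posrE ?exprn_gt0 ?ltr0n //.
by rewrite -natrX ler_nat.
Qed.

Lemma bd_width_le (G : sgraph) (D : branch_decomposition G) (n : nat) :
  reflect (forall x y : bd_tree D, adj x y ->
             (#|cut_nbhds (bd_side x y) (bd_side y x)| <= 2 ^ n)%N)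
    (bd_width R D <= n%:R).
Proof.
apply: (iffP (bigmax_leP _ _ _ _)) => [[_ H] x y xy|H].
  by rewrite -boolcut_le; apply: (H (x, y)).
by split=> // -[x y] /= xy; rewrite boolcut_le; apply: H.
Qed.

Lemma bd_width_ge0 (G : sgraph) (D : branch_decomposition G) : 0 <= bd_width R D.
Proof. exact: bigmax_ge_id. Qed.

Lemma boolwP (G : sgraph) :
  inhabited (branch_decomposition G) ->
  (exists D : branch_decomposition G, boolw R G = bd_width R D) /\
  forall D : branch_decomposition G, boolw R G <= bd_width R D.
Proof.
move=> [D0]; rewrite /boolw; set A := (fun w : R => _).
(* Every width is 0 or the logarithm of a number of vertex sets, so finitely many values are
   possible. *)
pose s := 0 :: [seq log2 (k%:R : R) | k <- iota 0 (#|{set G}|.+1)].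
have exA : exists m, A m /\ forall x, A x -> (m <= x)%O.
  apply: (@ex_minimum_seq _ _ A s); first by exists (bd_width R D0), D0.
  move=> _ [D ->]; rewrite /bd_width; elim/big_ind: _.
  - exact: mem_head.
  - by move=> x y; case: (leP x y).
  - move=> [x y] _; rewrite inE; apply/orP; right; apply/mapP.
    exists #|cut_nbhds (bd_side x y) (bd_side y x)| => //.
    by rewrite mem_iota ltnS max_card.
have [[D DE] minD] := minimumP 0 exA; split; first by exists D.
by move=> D'; apply: minD; exists D'.
Qed.

Lemma boolw_le_card (G : sgraph) : boolw R G <= #|G|%:R.
Proof.
have [exD|nD] := boolp.pselect (inhabited (branch_decomposition G)).
  have [[D ->] _] := boolwP exD; apply/bd_width_le => x y _.
  apply: leq_trans (leq_imset_card _ _) _; rewrite card_powerset.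
  by rewrite leq_exp2l // max_card.
rewrite /boolw minimum_default // => -[w [D _]]; exact: (nD (inhabits D)).
Qed.

End BooleanWidth.

Lemma ex_branch_decomposition (G : sgraph) :
  1 < #|G| -> inhabited (branch_decomposition G).
Proof.
move=> G1; have [||D _] := @branch_decomposition_buildable G (fun=> True) G1.
- by [].
- by apply: buildable_all => //; rewrite -card_gt0 cardsT ltnW.
- exact: (inhabits D).
Qed.

Lemma ltww_le_boolw (R : realType) (G : sgraph) :
  ltww G <= (2 ^ `|Num.ceil (boolw R G)|).*2.
Proof.
set n := `|Num.ceil _|%N.
have bound m : buildable (fun X : {set G} => #|types X| <= m) [set: G] ->
    ltww G <= m.*2.
  move=> /partition_sequence_buildable[P Ps Pm]; apply: leq_trans Pm.
  by have [_ ->] : _ /\ _ := @ltwwP G (ex_intro _ P Ps).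
have n0 : 0 < 2 ^ n by rewrite expn_gt0.
have tT : #|types [set: G]| <= 2 ^ n by apply: leq_trans (card_types_setT G) n0.
(* For the empty graph [ltww] is an empty maximum or the default, and is 0 in both cases. *)
have [G0|G0] := posnP #|G|.
  have [exP|nP] := boolp.pselect
      (exists P : nat -> {set {set G}}, partition_sequence P).
    have [[P _ ->] _] := ltwwP exP.
    by rewrite /partition_sequence_width G0 big_geq.
  by rewrite /ltww minimum_default // => -[k [P [Ps _]]]; apply: nP; exists P.
apply: bound; have [G1|G1] := leqP #|G| 1.
  have /card_gt0P[x _] := G0.
  have GE : [set: G] = [set x].
    by apply/esym/eqP; rewrite eqEcard subsetT cardsT cards1.
  by rewrite GE in tT *; apply: buildable1.
have [[D DE] _] := boolwP R (ex_branch_decomposition G1).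
apply: buildable_branch_decomposition G1 tT _ => x y xy.
(* The absolute value in [n] changes nothing, since the boolean-width is nonnegative. *)
have Dn : (bd_width R D <= n%:R)%R.
  rewrite -DE; apply: le_trans (ceil_ge _) _.
  rewrite /n natr_absz ger0_norm // ceil_ge0.
  by apply: lt_le_trans (ltrN10 _) _; rewrite DE bd_width_ge0.
apply: leq_trans (bd_width_le _ _ _ Dn _ _ xy).
(* A type is the cut neighbourhood of a singleton. *)
rewrite (bd_sideC xy); apply/subset_leq_card/subsetP => _ /imsetP[v vX ->].
by apply/imsetP; exists [set v]; rewrite // inE sub1set.
Qed.

Lemma boolw_le_ltww (R : realType) (G : sgraph) :
  (boolw R G <= (ltww G).+2%:R)%R.
Proof.
have [G1|G1] := leqP #|G| 1.
  apply: le_trans (boolw_le_card R G) _.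
  by rewrite ler_nat; apply: leq_trans G1 _.
have G0 := ltnW G1.
(* A tree with the trivial bound [#|G|] on types provides some partition sequence, so that [ltww] is
   an attained minimum and not the default. *)
have : buildable (fun X : {set G} => #|types X| <= #|G|) [set: G].
  apply: buildable_all; last by rewrite -card_gt0 cardsT.
  by move=> X; apply: leq_trans (leq_imset_card _ _) (max_card _).
case/partition_sequence_buildable => P0 P0s _.
have [[P Ps ->] _] := ltwwP (ex_intro _ P0 P0s).
have bG := buildable_partition_sequence G0 Ps.
have [D DP] := branch_decomposition_buildable G1 (@small_cutC _ _) bG.
apply: (@le_trans _ _ (bd_width R D)).
  by have [_] := boolwP R (ex_branch_decomposition G1); apply.
apply/bd_width_le => x y xy; rewrite (bd_sideC xy).
by have [] := DP x y xy.
Qed.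

Theorem theorem3p1 (R : realType) :
  exists f : nat -> nat, forall G : sgraph,
    (ltww G <= f `|Num.ceil (boolw R G)|)%N /\
    (boolw R G <= (f (ltww G))%:R)%R.
Proof.
(* The sum of the two bounds dominates each of them. *)
exists (fun n => (2 ^ n).*2 + n.+2) => G; split.
  by apply: leq_trans (leq_addr _ _); apply: ltww_le_boolw.
by apply: le_trans (boolw_le_ltww R G) _; rewrite ler_nat leq_addl.
Qed.
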